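(* For each pair $\{p,q\}$ of distinct parameters from the set $\{\text{area},\text{perimeter},\text{height},\text{width}\}$, there exists a rectangle visibility graph $G$ that requires distinct RV-representations to minimize $p$ and $q$: there are RV-representations $S_1$ and $S_2$ of $G$ with $p(G)=p(S_1)<p(S_2)$ and $q(G)=q(S_2)<q(S_1)$, and no RV-representation $S$ of $G$ satisfies both $p(S)=p(G)$ and $q(S)=q(G)$.
   Context: An integer rectangle is a set $[x_1,x_2]\times[y_1,y_2]$ with $x_1<x_2$, $y_1<y_2$ integers. Let $S$ be a finite set of integer rectangles with pairwise disjoint interiors (rectangles may share boundary edges). Two rectangles $A,B\in S$ see each other if there is a vertical or horizontal line segment that intersects the interiors of both $A$ and $B$ and intersects no other (closed) rectangle of $S$. $S$ is an RV-representation of a graph $G$ if the vertices of $G$ correspond bijectively to the rectangles of $S$ so that two vertices are adjacent if and only if their rectangles see each other. A graph having an RV-representation is a rectangle visibility graph (RVG). The bounding box of $S$ is the smallest axis-parallel rectangle $R$ containing all rectangles of $S$; it is always turned (rotated by $90^\circ$ if necessary) so that its height is at most its width. Thus the height of $R$ is its shorter side length and the width of $R$ is its longer side length. For an RV-representation $S$ and a parameter $p$ among area, perimeter, height, width, $p(S)$ denotes the value of $p$ for the bounding box of $S$, and for an RVG $G$, $p(G)$ is the minimum of $p(S)$ over all RV-representations $S$ of $G$. *)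

(* Defs.v *)
From HB Require Import structures.
From mathcomp Require Import all_boot all_order all_algebra finmap.
From mathcomp Require Import all_classical all_reals topology normedtype.

Set Implicit Arguments.
Unset Strict Implicit.
Unset Printing Implicit Defensive.

Import Order.TTheory GRing.Theory Num.Theory.
Import numFieldNormedType.Exports.
Local Open Scope classical_set_scope.
Local Open Scope ring_scope.

Record sgraph := SGraph {
  vertex :> finType;
  edge : rel vertex;
  edge_sym : symmetric edge;
  edge_irrefl : irreflexive edge }.

(* [corners] lists the coordinates as ((x1, x2), (y1, y2)). *)
Record irect := IRect {
  corners : (int * int) * (int * int);
  _ : (corners.1.1 < corners.1.2) && (corners.2.1 < corners.2.2) }.

HB.instance Definition _ := [isSub for corners].
HB.instance Definition _ := [Choice of irect by <:].

Definition rx1 (A : irect) : int := (corners A).1.1.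
Definition rx2 (A : irect) : int := (corners A).1.2.
Definition ry1 (A : irect) : int := (corners A).2.1.
Definition ry2 (A : irect) : int := (corners A).2.2.

Definition box (R : realType) (a b c d : R) : set (R * R) :=
  [set` `[a, b]] `*` [set` `[c, d]].

Definition region (R : realType) (A : irect) : set (R * R) :=
  box (rx1 A)%:~R (rx2 A)%:~R (ry1 A)%:~R (ry2 A)%:~R.

Arguments region : clear implicits.

Definition disjoint_interiors (R : realType) (S : {fset irect}) : Prop :=
  forall A B, A \in S -> B \in S -> A != B ->
    (region R A)° `&` (region R B)° = set0.

Definition horizontal_segment (R : realType) (s : set (R * R)) : Prop :=
  exists a b y : R, a < b /\ s = [set` `[a, b]] `*` [set y].

Definition vertical_segment (R : realType) (s : set (R * R)) : Prop :=
  exists x c d : R, c < d /\ s = [set x] `*` [set` `[c, d]].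

Definition sees (R : realType) (S : {fset irect}) (A B : irect) : Prop :=
  exists s : set (R * R),
    [/\ horizontal_segment s \/ vertical_segment s,
        s `&` (region R A)° !=set0,
        s `&` (region R B)° !=set0
      & forall C, C \in S -> C != A -> C != B -> s `&` region R C = set0].

Definition RV_representation (R : realType) (G : sgraph) (S : {fset irect}) :
    Prop :=
  disjoint_interiors R S /\
  exists f : G -> S, bijective f /\
    forall u v : G, u != v -> (edge u v <-> sees R S (val (f u)) (val (f v))).

Definition RVG (R : realType) (G : sgraph) : Prop :=
  exists S, RV_representation R G S.

Definition min_int (s : seq int) : int := foldr Num.min (head 0 s) s.
Definition max_int (s : seq int) : int := foldr Num.max (head 0 s) s.

(* Coordinates of the bounding box; [bbox_smallest] below shows that, as soon
   as [S] is nonempty, they do describe the smallest axis-parallel rectangle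
   (with arbitrary real corners) that contains all rectangles of [S]. *)
Definition bbox_x1 (S : {fset irect}) := min_int [seq rx1 A | A <- enum_fset S].
Definition bbox_x2 (S : {fset irect}) := max_int [seq rx2 A | A <- enum_fset S].
Definition bbox_y1 (S : {fset irect}) := min_int [seq ry1 A | A <- enum_fset S].
Definition bbox_y2 (S : {fset irect}) := max_int [seq ry2 A | A <- enum_fset S].

Definition bbox (R : realType) (S : {fset irect}) : set (R * R) :=
  box (bbox_x1 S)%:~R (bbox_x2 S)%:~R (bbox_y1 S)%:~R (bbox_y2 S)%:~R.

Arguments bbox : clear implicits.

Definition bbox_dx (S : {fset irect}) : int := bbox_x2 S - bbox_x1 S.
Definition bbox_dy (S : {fset irect}) : int := bbox_y2 S - bbox_y1 S.

Inductive param := Area | Perimeter | Height | Width.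

(* The bounding box is turned so that its height is at most its width: height
   and width are the shorter and the longer side length, whatever the
   orientation of [S]. *)
Definition param_rep (p : param) (S : {fset irect}) : int :=
  match p with
  | Area => bbox_dx S * bbox_dy S
  | Perimeter => 2 * (bbox_dx S + bbox_dy S)
  | Height => Num.min (bbox_dx S) (bbox_dy S)
  | Width => Num.max (bbox_dx S) (bbox_dy S)
  end.

(* [param_graph R p G m] reads p(G) = m. *)
Definition param_graph (R : realType) (p : param) (G : sgraph) (m : int) :
    Prop :=
  (exists2 S, RV_representation R G S & param_rep p S = m) /\
  (forall S, RV_representation R G S -> m <= param_rep p S).

Lemma min_int_le (s : seq int) x : x \in s -> min_int s <= x.
Proof.
rewrite /min_int; move: (head 0 s) => h; elim: s => //= y s IHs.
by rewrite inE ge_min => /predU1P[->|/IHs->]; rewrite ?lexx ?orbT.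
Qed.

Lemma max_int_ge (s : seq int) x : x \in s -> x <= max_int s.
Proof.
rewrite /max_int; move: (head 0 s) => h; elim: s => //= y s IHs.
by rewrite inE le_max => /predU1P[->|/IHs->]; rewrite ?lexx ?orbT.
Qed.

Lemma min_int_in (s : seq int) : s != [::] -> min_int s \in s.
Proof.
case: s => // x s _; rewrite /min_int /= minEle.
case: ifP => _; first exact: mem_head.
elim: s => /= [|y s IHs]; first exact: mem_head.
by rewrite minEle; case: ifP; rewrite !inE ?eqxx ?orbT // => _;
  move: IHs; rewrite inE => /orP[]->; rewrite ?orbT.
Qed.

Lemma max_int_in (s : seq int) : s != [::] -> max_int s \in s.
Proof.
case: s => // x s _; rewrite /max_int /= maxEle.
case: ifP => _; last exact: mem_head.
elim: s => /= [|y s IHs]; first exact: mem_head.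
by rewrite maxEle; case: ifP; rewrite !inE ?eqxx ?orbT // => _;
  move: IHs; rewrite inE => /orP[]->; rewrite ?orbT.
Qed.

Lemma bbox_smallest (R : realType) (S : {fset irect}) : S != fset0 ->
  (forall A, A \in S -> region R A `<=` bbox R S) /\
  (forall a b c d : R, (forall A, A \in S -> region R A `<=` box a b c d) ->
     bbox R S `<=` box a b c d).
Proof.
move=> /fset0Pn[A0 A0S].
have ne (f : irect -> int) : [seq f A | A <- enum_fset S] != [::].
  by move: (A0S : A0 \in enum_fset S); case: (enum_fset S).
split=> [A AS [x y]|a b c d sub [x y]].
  rewrite /region /bbox /box /= !in_itv /= => -[/andP[x1 x2] /andP[y1 y2]].
  have AS' : A \in enum_fset S by [].
  split; apply/andP; split.
  - by apply: le_trans x1; rewrite ler_int min_int_le ?map_f.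
  - by apply: le_trans x2 _; rewrite ler_int max_int_ge ?map_f.
  - by apply: le_trans y1; rewrite ler_int min_int_le ?map_f.
  - by apply: le_trans y2 _; rewrite ler_int max_int_ge ?map_f.
have in1 A : A \in S -> box a b c d ((rx1 A)%:~R, (ry1 A)%:~R).
  move=> AS; apply: (sub A AS); have /andP[/ltW lx /ltW ly] := valP A.
  by split; rewrite /= in_itv /= lexx ler_int.
have in2 A : A \in S -> box a b c d ((rx2 A)%:~R, (ry2 A)%:~R).
  move=> AS; apply: (sub A AS); have /andP[/ltW lx /ltW ly] := valP A.
  by split; rewrite /= in_itv /= lexx ler_int ?lx ?ly.
rewrite /bbox /box /= !in_itv /= => -[/andP[x1 x2] /andP[y1 y2]].
split; apply/andP; split.
- have /mapP[A AS E] := min_int_in (ne rx1).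
  have [/= + _] := in1 A AS; rewrite in_itv /= => /andP[le _].
  by apply: le_trans le _; rewrite -E.
- have /mapP[A AS E] := max_int_in (ne rx2).
  have [/= + _] := in2 A AS; rewrite in_itv /= => /andP[_ le].
  by apply: le_trans _ le; rewrite -E.
- have /mapP[A AS E] := min_int_in (ne ry1).
  have [/= _ +] := in1 A AS; rewrite in_itv /= => /andP[le _].
  by apply: le_trans le _; rewrite -E.
- have /mapP[A AS E] := max_int_in (ne ry2).
  have [/= _ +] := in2 A AS; rewrite in_itv /= => /andP[_ le].
  by apply: le_trans _ le; rewrite -E.
Qed.

(* Main.v *)
Require Import Defs.
From mathcomp Require Import all_boot all_order all_algebra finmap.
From mathcomp Require Import reals.
From mathcomp Require Import all_classical topology normedtype zify lra.

(** A sightline can be moved into the middle of a unit strip of the integer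
    grid: two rectangles see each other exactly when some row or column of unit
    cells meets both of them and no third rectangle between them
    ([sees_sight], [sight_sees]).  So a representation with an a x b bounding
    box is a labelling of the a x b grid of cells, each cell bearing the vertex
    whose rectangle covers it or a blank; consecutive labels along a row or
    column are equal or adjacent, and every edge occurs so
    ([owner_drawing]).  Whether a graph has such a labelling is a finite
    question, and a cell by cell search that abandons a partial labelling at
    its first violated rule settles it ([search_drawing]).

    To separate p from q it is enough to exhibit a representation with p at
    most s and one with q at most t, and to show that none has both: the
    minimizers of p and of q then differ in the required way
    ([separates_bounds]).  Joint bounds p <= s and q <= t leave only a few
    small boxes, which the search refutes.  Three graphs serve all six pairs.

    - The star with four leaves fits a 3 x 3 box, as a plus sign.  In two rows
      the centre must be two units high with two leaves on either side, and
      since no two leaves may see each other every leaf needs a column of its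
      own: this gives a 2 x 5 box, and height 2 with area at most 9 is
      impossible.

    - The ladder with five rungs fits a 2 x 5 box, and a 4 x 4 box when it
      turns a corner.  Longer side 4 together with height 2, area 10 or
      semiperimeter 7 would put it in a 3 x 4 box, which is impossible.

    - The ladder with four rungs and a square hung on one of its corner
      vertices fits a 2 x 7 box (area 14, semiperimeter 9), where the common
      vertex is two units high, and a 3 x 5 box (area 15, semiperimeter 8),
      where it is a unit square with the hung square beyond it.
      Semiperimeter 8 together with area 14 or height 2 would require a 1 x 7,
      2 x 6 or 3 x 4 box, and none of these is possible. *)

Set Implicit Arguments.
Unset Strict Implicit.
Unset Printing Implicit Defensive.

Import Order.TTheory GRing.Theory Num.Theory.
Import numFieldNormedType.Exports.

(** * Labelled grids *)

Definition adjacent (es : seq (nat * nat)) (u v : nat) : bool :=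
  (u != v) && (((u, v) \in es) || ((v, u) \in es)).

(** The rules along the first coordinate; a label below [n] is a vertex and [n]
    is a blank cell. *)
Record line_rule (n : nat) (es : seq (nat * nat)) (lab : nat -> nat -> nat) :
    Prop := {
  line_convex : forall i k i' j, i < k < i' -> lab i j < n ->
    lab i' j = lab i j -> lab k j = lab i j;
  line_sight : forall i i' j, i < i' -> lab i j < n -> lab i' j < n ->
    (forall k, i < k < i' -> lab k j = n) ->
    lab i j = lab i' j \/ adjacent es (lab i j) (lab i' j) }.

(** Two consecutive labels of a line of cells: what a sightline along that line
    sees. *)
Definition faces (n : nat) (lab : nat -> nat -> nat) (a b u v : nat) : Prop :=
  exists i i' j, [/\ i < i', i' < a & j < b] /\
    [/\ lab i j = u, lab i' j = v & forall k, i < k < i' -> lab k j = n].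

(** What a representation of the graph looks like on an [a] x [b] grid of unit
    cells; [lab i j] is the label of the cell in column [i] and row [j]. *)
Record drawing (n : nat) (es : seq (nat * nat)) (a b : nat)
    (lab : nat -> nat -> nat) : Prop := {
  drawing_lab : forall i j, lab i j <= n;
  drawing_rect : forall i j i' j', lab i j < n -> lab i' j' = lab i j ->
    lab i j' = lab i j;
  drawing_rows : line_rule n es lab;
  drawing_cols : line_rule n es (fun j i => lab i j);
  drawing_onto : forall v, v < n -> exists i j, [/\ i < a, j < b & lab i j = v];
  drawing_edges : forall u v, u < n -> v < n -> adjacent es u v ->
    [\/ faces n lab a b u v, faces n lab a b v u,
        faces n (fun j i => lab i j) b a u v |
        faces n (fun j i => lab i j) b a v u] }.

Definition transpose (lab : nat -> nat -> nat) : nat -> nat -> nat :=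
  fun j i => lab i j.

(** * Searching for a labelled grid *)

(** Cells are labelled row by row, and a partial labelling is listed with its
    latest label first.  [leftward] and [upward] are the labels to the left of
    and above the next cell, nearest first, in a grid of [a] columns. *)
Definition leftward (n a : nat) (p : seq nat) : seq nat :=
  [seq nth n p t | t <- iota 0 (size p %% a)].
Definition upward (n a : nat) (p : seq nat) : seq nat :=
  [seq nth n p (t.+1 * a).-1 | t <- iota 0 (size p %/ a)].

Fixpoint nearest (n : nat) (l : seq nat) : nat :=
  if l is x :: l' then if x == n then nearest n l' else x else n.

Definition line_ok (n : nat) (es : seq (nat * nat)) (l : seq nat) (v : nat) :=
  [&& (nearest n l == n) || (nearest n l == v) || adjacent es (nearest n l) v
    & (v \in l) ==> (head n l == v)].

(** The four cells of a 2 x 2 window, [d] diagonal to the new label [v]: a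
    rectangle that covers two opposite cells covers all four. *)
Definition window_ok (n d u l v : nat) : bool :=
  ((d == v) && (v != n) ==> (u == v) && (l == v)) &&
  ((u == l) && (l != n) ==> (d == l) && (v == l)).

Definition allowed (n : nat) (es : seq (nat * nat)) (a : nat) (p : seq nat)
    (v : nat) : bool :=
  let L := leftward n a p in let U := upward n a p in
  [&& (v == n) || [&& line_ok n es L v, line_ok n es U v
                    & (v \in p) ==> ((head n L == v) || (head n U == v))]
    & nilp L || nilp U || window_ok n (nth n p a) (head n U) (head n L) v].

Fixpoint sightings (n a : nat) (p : seq nat) : seq (nat * nat) :=
  if p is v :: p' then
    [:: (nearest n (leftward n a p'), v), (nearest n (upward n a p'), v)
      & sightings n a p']
  else [::].

Definition missing (n : nat) (p : seq nat) : seq nat :=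
  [seq v <- iota 0 n | v \notin p].

Definition edges_sighted (n : nat) (es : seq (nat * nat)) (a : nat) (p : seq nat) :=
  let s := sightings n a p in
  all (fun e => (e \in s) || ((e.2, e.1) \in s)) es.

(** Strict evaluation computes both arguments of a conjunction, so the pruning
    tests are conditionals.  The first one prunes when there are fewer cells
    left than vertices still to appear. *)
Fixpoint search (n : nat) (es : seq (nat * nat)) (a m : nat) (p : seq nat) :=
  if m is m'.+1 then
    if size (missing n p) <= m then
      has (fun v => if allowed n es a p v then search n es a m' (v :: p)
                    else false) (iota 0 n.+1)
    else false
  else edges_sighted n es a p.

Fixpoint line (lab : nat -> nat -> nat) (j c : nat) : seq nat :=
  if c is i.+1 then lab i j :: line lab j i else [::].

(** The first [m] labels of a labelling in the order of the search. *)
Fixpoint reading (lab : nat -> nat -> nat) (a m : nat) : seq nat :=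
  if m is k.+1 then lab (k %% a) (k %/ a) :: reading lab a k else [::].

Lemma lineE lab j c :
  line lab j c = [seq lab (c - t.+1) j | t <- iota 0 c].
Proof.
elim: c => //= c ->; rewrite subn1 /=; congr cons.
by rewrite (iotaDl 1 0) -map_comp.
Qed.

Lemma size_reading lab a m : size (reading lab a m) = m.
Proof. by elim: m => //= m ->. Qed.

Lemma nth_reading x0 lab a m t : t < m ->
  nth x0 (reading lab a m) t = lab ((m - t.+1) %% a) ((m - t.+1) %/ a).
Proof. by elim: m t => // m IHm [_|t /IHm] /=; rewrite ?subn1. Qed.

Lemma mem_reading lab a m k : k < m -> lab (k %% a) (k %/ a) \in reading lab a m.
Proof.
elim: m => //= m IHm; rewrite ltnS leq_eqVlt inE => /predU1P[->|/IHm ->].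
  by rewrite eqxx.
by rewrite orbT.
Qed.

Lemma reading_mem lab a m v : v \in reading lab a m ->
  exists2 k, k < m & lab (k %% a) (k %/ a) = v.
Proof.
elim: m => //= m IHm; rewrite inE => /predU1P[->|/IHm[k lkm <-]].
  by exists m.
by exists k => //; apply: ltnW.
Qed.

Lemma coordK a i j : i < a -> ((j * a + i) %% a = i) * ((j * a + i) %/ a = j).
Proof.
move=> lt_ia; have a0 : 0 < a by apply: leq_ltn_trans lt_ia.
by rewrite modnMDl modn_small // divnMDl // divn_small // addn0.
Qed.

Lemma leftward_reading n lab a i j : i < a ->
  leftward n a (reading lab a (j * a + i)) = line lab j i.
Proof.
move=> lt_ia; rewrite lineE /leftward size_reading !coordK //.
apply/eq_in_map => t; rewrite mem_iota /= add0n => lt_ti.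
rewrite nth_reading; last lia.
have -> : j * a + i - t.+1 = j * a + (i - t.+1) by lia.
by rewrite !coordK //; lia.
Qed.

Lemma upward_reading n lab a i j : i < a ->
  upward n a (reading lab a (j * a + i)) = line (transpose lab) i j.
Proof.
move=> lt_ia; rewrite lineE /upward size_reading !coordK //.
apply/eq_in_map => t; rewrite mem_iota /= add0n => lt_tj.
have le_tj : t.+1 * a <= j * a by rewrite leq_mul2r lt_tj orbT.
rewrite nth_reading; last nia.
have -> : j * a + i - (t.+1 * a).-1.+1 = (j - t.+1) * a + i.
  by rewrite mulnBl prednK; nia.
by rewrite !coordK.
Qed.

Lemma nearest_line n lab j c i : i < c -> lab i j != n ->
  (forall k, i < k < c -> lab k j = n) -> nearest n (line lab j c) = lab i j.
Proof.
elim: c => //= c IHc; rewrite ltnS leq_eqVlt => /predU1P[->|lt_ic] Ni Nk.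
  by rewrite (negPf Ni).
rewrite (Nk c) ?lt_ic ?ltnSn // eqxx IHc // => k /andP[lt_ik lt_kc].
by rewrite Nk // lt_ik ltnS ltnW.
Qed.

Lemma nearest_lineP n lab j c : nearest n (line lab j c) != n ->
  exists2 i, i < c /\ lab i j = nearest n (line lab j c)
    & forall k, i < k < c -> lab k j = n.
Proof.
elim: c => [|c IHc] /=; first by rewrite eqxx.
case: (eqVneq (lab c j) n) => [Nc /IHc[i [lt_ic Ei] Nk]|Nc _].
  exists i; first by split=> //; apply: ltnW.
  move=> k; rewrite ltnS => /andP[lt_ik]; rewrite leq_eqVlt.
  by case/predU1P=> [->//|lt_kc]; apply: Nk; rewrite lt_ik.
by exists c => // k; rewrite ltnS; case: ltngtP.
Qed.

Lemma line_mem lab j c v : v \in line lab j c ->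
  exists2 i, i < c & lab i j = v.
Proof.
elim: c => //= c IHc; rewrite inE => /predU1P[->|/IHc[i lt_ic <-]].
  by exists c.
by exists i => //; apply: ltnW.
Qed.

Lemma line_ok_drawing n es lab j c : line_rule n es lab ->
  (forall i k, lab i k <= n) -> lab c j < n ->
  line_ok n es (line lab j c) (lab c j).
Proof.
move=> [convex see] lab_le ltn; apply/andP; split.
  have [->//|/= N] := eqVneq (nearest n (line lab j c)) n.
  have [i [lt_ic Ei] Nk] := nearest_lineP N.
  have lti : lab i j < n by rewrite ltn_neqAle lab_le Ei N.
  by rewrite -Ei; have [->|->] := see i c j lt_ic lti ltn Nk; rewrite ?eqxx ?orbT.
apply/implyP => /line_mem[i]; case: c ltn => // c ltn; rewrite ltnS leq_eqVlt.
case/predU1P=> [-> /= ->//|lt_ic Ei]; apply/eqP => /=; rewrite -Ei.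
by apply: (convex i c c.+1 j); rewrite ?lt_ic ?ltnS //= Ei.
Qed.

(** If the new cell's vertex occurred before, it occurs just to the left or just
    above: to the left by convexity when the earlier cell is in the same row,
    and otherwise above, since the rectangle then also covers the cell of the
    present column in the earlier row. *)
Lemma allowed_drawing n es a b lab i j : drawing n es a b lab -> i < a ->
  allowed n es a (reading lab a (j * a + i)) (lab i j).
Proof.
move=> D lt_ia; have lab_le := drawing_lab D; have rect := drawing_rect D.
rewrite /allowed leftward_reading // upward_reading //; apply/andP; split.
  have [//|/= N] := eqVneq (lab i j) n.
  have lt_n : lab i j < n by rewrite ltn_neqAle N lab_le.
  have okL := line_ok_drawing (drawing_rows D) lab_le lt_n.
  have okU := @line_ok_drawing n es (transpose lab) i j (drawing_cols D)
    (fun x y => lab_le y x) lt_n.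
  rewrite okL okU /=; apply/implyP => /reading_mem[k lt_k Ek].
  have lt_ka : k %% a < a by apply: ltn_pmod; lia.
  have Dk := divn_eq k a.
  move: (k %% a) (k %/ a) lt_ka Dk Ek => i' j' lt_i'a Dk Ek.
  have [Ej|nEj] := eqVneq j' j.
    move: okL => /andP[_ /implyP-> //].
    rewrite -Ek Ej; have lt_i'i : i' < i by subst; lia.
    elim: (i) lt_i'i => //= m IH; rewrite ltnS leq_eqVlt inE.
    by case/predU1P=> [->|/IH->]; rewrite ?eqxx ?orbT.
  have lt_j'j : j' < j by nia.
  move: okU => /andP[_ /implyP->]; first by rewrite orbT.
  change (lab i j \in line (transpose lab) i j).
  rewrite -(rect i j i' j' lt_n Ek).
  elim: (j) lt_j'j => //= m IH; rewrite ltnS leq_eqVlt inE.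
  by case/predU1P=> [->|/IH->]; rewrite ?eqxx ?orbT.
case: i lt_ia => //= i lt_ia; case: j => //= j.
rewrite nth_reading; last nia.
have -> : j.+1 * a + i.+1 - a.+1 = j * a + i by lia.
rewrite !coordK ?(ltnW lt_ia) // /transpose; apply/andP; split.
  apply/implyP => /andP[/eqP E N].
  have lt_n : lab i.+1 j.+1 < n by rewrite ltn_neqAle N lab_le.
  rewrite (rect _ _ _ _ lt_n E) eqxx /= -E.
  by apply/eqP; apply: (rect i j i.+1 j.+1); rewrite ?E.
apply/implyP => /andP[/eqP E N].
have lt_n : lab i j.+1 < n by rewrite ltn_neqAle N lab_le.
rewrite (rect _ _ _ _ lt_n E) eqxx /= -E.
by apply/eqP; apply: (rect i.+1 j i j.+1); rewrite ?E.
Qed.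

(** Every missing vertex labels one of the cells not yet read. *)
Lemma missing_drawing n es a b lab m : drawing n es a b lab -> m <= a * b ->
  size (missing n (reading lab a m)) <= a * b - m.
Proof.
move=> D le_m; rewrite -[leqRHS](size_iota m)
  -[leqRHS](size_map (fun k => lab (k %% a) (k %/ a))).
apply: uniq_leq_size; first exact/filter_uniq/iota_uniq.
move=> v; rewrite mem_filter mem_iota add0n /= => /andP[Nv lt_v].
have [i [j [lt_ia lt_jb Ev]]] := drawing_onto D lt_v.
apply/mapP; exists (j * a + i); last by rewrite !coordK.
rewrite mem_iota subnKC // andbC; apply/andP; split; first nia.
rewrite leqNgt; apply: contra Nv => lt_m.
by rewrite -Ev -{1}(coordK j lt_ia).1 -{2}(coordK j lt_ia).2 mem_reading.
Qed.

Lemma sightings_reading n lab a m k : k < m ->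
  let w := reading lab a k in let v := lab (k %% a) (k %/ a) in
  ((nearest n (leftward n a w), v) \in sightings n a (reading lab a m)) &&
  ((nearest n (upward n a w), v) \in sightings n a (reading lab a m)).
Proof.
elim: m => //= m IHm; rewrite ltnS leq_eqVlt => /predU1P[->|/IHm/andP[]].
  by rewrite !inE !eqxx !orbT.
by rewrite !inE => -> ->; rewrite !orbT.
Qed.

Lemma faces_sightings n lab a b u v : u < n -> faces n lab a b u v ->
  (u, v) \in sightings n a (reading lab a (a * b)).
Proof.
move=> lt_un [i [i' [j [[lt_ii' lt_i'a lt_jb] [Eu Ev Nk]]]]].
have /(sightings_reading n lab a)/andP[+ _] : j * a + i' < a * b by nia.
rewrite leftward_reading // !coordK // (nearest_line lt_ii') ?Eu ?Ev //.
by rewrite neq_ltn lt_un.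
Qed.

Lemma faces_sightings_transpose n lab a b u v : u < n ->
  faces n (transpose lab) b a u v ->
  (u, v) \in sightings n a (reading lab a (a * b)).
Proof.
move=> lt_un [i [i' [j [[lt_ii' lt_i'b lt_ja] [Eu Ev Nk]]]]].
have /(sightings_reading n lab a)/andP[_ ] : i' * a + j < a * b by nia.
rewrite upward_reading // !coordK // (nearest_line lt_ii') ?Eu //.
  by rewrite -Ev.
by rewrite neq_ltn lt_un.
Qed.

Definition simple_edges (n : nat) (es : seq (nat * nat)) : bool :=
  all (fun e => [&& e.1 < n, e.2 < n & e.1 != e.2]) es.

Lemma edges_sighted_drawing n es a b lab : simple_edges n es -> drawing n es a b lab ->
  edges_sighted n es a (reading lab a (a * b)).
Proof.
move=> /allP simple_es D; apply/allP => -[u v] uv.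
have /and3P[/= lt_un lt_vn neq_uv] := simple_es _ uv.
have [|/(faces_sightings lt_un)->//|/(faces_sightings lt_vn)->|
  /(faces_sightings_transpose lt_un)->//|
  /(faces_sightings_transpose lt_vn)->] := drawing_edges D lt_un lt_vn;
  rewrite ?orbT //.
by rewrite /adjacent neq_uv uv.
Qed.

Lemma search_step n es a m p v : size (missing n p) <= m.+1 -> v <= n ->
  allowed n es a p v -> search n es a m (v :: p) -> search n es a m.+1 p.
Proof.
move=> le_miss le_vn ok IH.
change (is_true (if size (missing n p) <= m.+1 then
  has (fun v => if allowed n es a p v then search n es a m (v :: p) else false)
    (iota 0 n.+1) else false)).
by rewrite le_miss; apply/hasP; exists v; rewrite ?ok // mem_iota ltnS.
Qed.

(** The search succeeds whenever a drawing exists, because reading the drawing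
    is one of the branches and no test closes it. *)
Lemma search_drawing n es a b lab : simple_edges n es -> drawing n es a b lab ->
  search n es a (a * b) [::].
Proof.
move=> simple_es D.
suff H m : m <= a * b -> search n es a m (reading lab a (a * b - m)).
  by have := H _ (leqnn _); rewrite subnn.
elim: m => [_|m IHm lt_m]; first by rewrite /= subn0 edges_sighted_drawing.
have lt_ka : (a * b - m.+1) %% a < a by apply: ltn_pmod; nia.
apply: (search_step (v := lab ((a * b - m.+1) %% a) ((a * b - m.+1) %/ a))).
- by have := missing_drawing D (leq_subr m.+1 (a * b)); rewrite subKn.
- exact: drawing_lab D _ _.
- by have := allowed_drawing ((a * b - m.+1) %/ a) D lt_ka; rewrite -divn_eq.
have := IHm (ltnW lt_m).
by have -> : a * b - m = (a * b - m.+1).+1 by lia.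
Qed.

(** * Sightlines and unit strips *)

Local Open Scope classical_set_scope.
Local Open Scope ring_scope.

(** The axis [d] is horizontal for [true] and vertical for [false], so that one
    proof serves sightlines of both directions: [spans d k A] says that [A]
    covers the unit strip from k to k + 1 of the coordinate along [d], and
    [at_axis d u v] is the point with coordinate [u] along [d]. *)
Definition lo (d : bool) (A : irect) : int := if d then rx1 A else ry1 A.
Definition hi (d : bool) (A : irect) : int := if d then rx2 A else ry2 A.
Definition spans (d : bool) (k : int) (A : irect) : bool := lo d A <= k < hi d A.
Definition at_axis (T : Type) (d : bool) (u v : T) : T * T :=
  if d then (u, v) else (v, u).

Definition apart (A B : irect) : bool :=
  has (fun d => (hi d A <= lo d B) || (hi d B <= lo d A)) [:: true; false].

(** Visibility along axis [d] inside the unit strip [k] of the other axis; each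
    third rectangle of the strip lies before or after both [A] and [B]. *)
Definition sight (S : {fset irect}) (d : bool) (k : int) (A B : irect) : Prop :=
  [/\ spans (~~ d) k A, spans (~~ d) k B
    & forall C, C \in S -> C != A -> C != B -> spans (~~ d) k C ->
        (hi d C <= Num.min (lo d A) (lo d B))
        || (Num.max (hi d A) (hi d B) <= lo d C)].

Lemma lo_lt_hi d A : lo d A < hi d A.
Proof. by have /andP[] := valP A; case: d. Qed.

Lemma interior_box (R : realType) (a b c d : R) :
  (box a b c d)° = [set` `]a, b[] `*` [set` `]c, d[].
Proof.
rewrite -(interior_itv_bnd a b true false) -(interior_itv_bnd c d true false).
apply/seteqP; split=> [[x y] [[P Q] [/= Px Qy] PQ]|[x y] [/= Ix Iy]].
  split; [apply: filterS Px | apply: filterS Qy] => z Hz.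
    by have [] := PQ (z, y) (conj Hz (nbhs_singleton Qy)).
  by have [] := PQ (x, z) (conj (nbhs_singleton Px) Hz).
by exists ([set` `[a, b]], [set` `[c, d]]).
Qed.

Lemma region_at (R : realType) (A : irect) d (u v : R) :
  region R A (at_axis d u v) <->
  ((lo d A)%:~R <= u <= (hi d A)%:~R) &&
  ((lo (~~ d) A)%:~R <= v <= (hi (~~ d) A)%:~R).
Proof.
rewrite /region /box /=; case: d => /=; rewrite !in_itv /=.
  by split=> [[-> ->]|/andP[]].
by split=> [[-> ->]|/andP[]].
Qed.

Lemma interior_at (R : realType) (A : irect) d (u v : R) :
  (region R A)° (at_axis d u v) <->
  ((lo d A)%:~R < u < (hi d A)%:~R) &&
  ((lo (~~ d) A)%:~R < v < (hi (~~ d) A)%:~R).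
Proof.
rewrite /region interior_box; case: d => /=; rewrite !in_itv /=.
  by split=> [[-> ->]|/andP[]].
by split=> [[-> ->]|/andP[]].
Qed.

Lemma at_axis_surj (T : Type) d (p : T * T) : exists u v, p = at_axis d u v.
Proof. by case: p => x y; case: d; [exists x, y | exists y, x]. Qed.

(** Midpoints of unit cells never lie on the boundary of an integer
    rectangle. *)
Lemma half_le (R : realType) (z k : int) :
  (z%:~R <= k%:~R + 2^-1 :> R) = (z <= k).
Proof.
apply/idP/idP => [le_zk|]; last by rewrite -(ler_int R) => ?; lra.
rewrite -ltzD1 -(ltr_int R) intrD; lra.
Qed.

Lemma half_lt (R : realType) (z k : int) :
  (z%:~R < k%:~R + 2^-1 :> R) = (z <= k).
Proof.
apply/idP/idP => [/ltW|]; first by rewrite half_le.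
by rewrite -(ler_int R) => ?; lra.
Qed.

Lemma half_ge (R : realType) (z k : int) :
  (k%:~R + 2^-1 <= z%:~R :> R) = (k < z).
Proof. by rewrite leNgt half_lt -ltNge. Qed.

Lemma half_gt (R : realType) (z k : int) :
  (k%:~R + 2^-1 < z%:~R :> R) = (k < z).
Proof. by rewrite ltNge half_le -ltNge. Qed.

Lemma interior_cell (R : realType) A d (i k : int) :
  (region R A)° (at_axis d (i%:~R + 2^-1) (k%:~R + 2^-1)) <->
  spans d i A && spans (~~ d) k A.
Proof. by rewrite interior_at /spans !half_lt !half_gt. Qed.

(** If neither rectangle came first in the common strip, the cell of the strip
    that starts at the larger of the two lower bounds would lie in both. *)
Lemma strip_apart (R : realType) S A B d k :
  disjoint_interiors R S -> A \in S -> B \in S -> A != B ->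
  spans (~~ d) k A -> spans (~~ d) k B ->
  (hi d A <= lo d B) || (hi d B <= lo d A).
Proof.
move=> disj AS BS AB kA kB; rewrite -[_ || _]negbK negb_or -!ltNge.
apply/negP => /andP[lt1 lt2]; pose i := Num.max (lo d A) (lo d B).
suff: ((region R A)° `&` (region R B)°) (at_axis d (i%:~R + 2^-1) (k%:~R + 2^-1)).
  by rewrite (disj A B).
have [ltA ltB] := (lo_lt_hi d A, lo_lt_hi d B).
by split; apply/interior_cell; rewrite ?kA ?kB andbT /spans /i; clear - lt1 lt2 ltA ltB; lia.
Qed.

Lemma apart_interiors (R : realType) A B : apart A B ->
  (region R A)° `&` (region R B)° = set0.
Proof.
move=> /hasP[d _ sepd]; rewrite -subset0 => p; have [u [v ->]] := at_axis_surj d p.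
move=> [/interior_at/andP[/andP[a1 a2] _] /interior_at/andP[/andP[b1 b2] _]].
case/orP: sepd; rewrite -(ler_int R); lra.
Qed.

Lemma segment_axis (R : realType) (s : set (R * R)) :
  horizontal_segment s \/ vertical_segment s ->
  exists d a b y, a < b /\
    forall u v, s (at_axis d u v) <-> (a <= u <= b) /\ v = y.
Proof.
case=> [[a [b [y [ab ->]]]]|[y [a [b [ab ->]]]]].
  exists true, a, b, y; split=> // u v /=; rewrite in_itv.
by exists false, a, b, y; split=> // u v /=; rewrite in_itv /=; split=> -[? ?]; split.
Qed.

Lemma axis_segment (R : realType) d (a b y : R) : a < b ->
  exists s, (horizontal_segment s \/ vertical_segment s) /\
    forall u v, s (at_axis d u v) <-> (a <= u <= b) /\ v = y.
Proof.
move=> ab; case: d.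
  exists ([set` `[a, b]] `*` [set y]); split; first by left; exists a, b, y.
  by move=> u v /=; rewrite in_itv /=; split=> -[? ?]; split.
exists ([set y] `*` [set` `[a, b]]); split; first by right; exists y, a, b.
by move=> u v /=; rewrite in_itv /=; split=> -[? ?]; split.
Qed.

(** The strip of a sightline is the one that contains its fixed coordinate y.  A
    third rectangle that covers the strip has y in its closed range, and must
    therefore lie entirely before or entirely after the segment. *)
Lemma sees_sight (R : realType) S A B :
  disjoint_interiors R S -> A \in S -> B \in S ->
  sees R S A B -> exists d k, sight S d k A B.
Proof.
move=> disj AS BS [s [/segment_axis[d [a [b [y [ab sE]]]]] [p +] [q +] clear]].
have [u [v ->]] := at_axis_surj d p; have [u' [v' ->]] := at_axis_surj d q.
move=> [/sE[aub ->] /interior_at/andP[/andP[A1 A2] /andP[A3 A4]]].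
move=> [/sE[au'b ->] /interior_at/andP[/andP[B1 B2] /andP[B3 B4]]].
have kA : spans (~~ d) (Num.floor y) A.
  by rewrite /spans floor_ge_int floor_lt_int (ltW A3).
have kB : spans (~~ d) (Num.floor y) B.
  by rewrite /spans floor_ge_int floor_lt_int (ltW B3).
exists d, (Num.floor y); split=> // C CS CA CB kC.
have sepA := strip_apart disj CS AS CA kC kA.
have sepB := strip_apart disj CS BS CB kC kB.
have [ltA [ltB ltC]] := (lo_lt_hi d A, (lo_lt_hi d B, lo_lt_hi d C)).
have [lt|lt] : (hi d C)%:~R < a \/ b < (lo d C)%:~R.
  apply: contrapT => /not_orP[/negP + /negP]; rewrite -!leNgt => le1 le2.
  suff : (s `&` region R C) (at_axis d (Num.max a (lo d C)%:~R) y).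
    by rewrite (clear C).
  split; first by apply/sE; split=> //; rewrite le_max lexx ge_max le2 (ltW ab).
  apply/region_at; rewrite le_max lexx orbT ge_max le1 ler_int (ltW ltC) /=.
  move: kC; rewrite /spans floor_ge_int floor_lt_int => /andP[-> /ltW ->].
  done.
- have : (hi d C)%:~R < (hi d A)%:~R :> R by lra.
  have : (hi d C)%:~R < (hi d B)%:~R :> R by lra.
  rewrite !ltr_int; clear - sepA sepB ltA ltB ltC; lia.
- have : (lo d A)%:~R < (lo d C)%:~R :> R by lra.
  have : (lo d B)%:~R < (lo d C)%:~R :> R by lra.
  rewrite !ltr_int; clear - sepA sepB ltA ltB ltC; lia.
Qed.

(** The segment runs along the middle of the strip, from the middle of the last
    cell of the first rectangle to the middle of the first cell of the second
    one. *)
Lemma sight_sees (R : realType) S d k A B :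
  disjoint_interiors R S -> A \in S -> B \in S -> A != B ->
  sight S d k A B -> sees R S A B.
Proof.
move=> disj AS BS AB [kA kB clear].
have sepAB := strip_apart disj AS BS AB kA kB.
have [ltA ltB] := (lo_lt_hi d A, lo_lt_hi d B).
pose i := Num.min (hi d A) (hi d B) - 1; pose j := Num.max (lo d A) (lo d B).
have lt_ij : i%:~R + 2^-1 < j%:~R + 2^-1 :> R by rewrite ltrD2r ltr_int /i /j; clear - ltA ltB sepAB; lia.
have [s [sseg sE]] := axis_segment d (k%:~R + 2^-1) lt_ij.
have in_s (l : int) : i <= l <= j -> s (at_axis d (l%:~R + 2^-1) (k%:~R + 2^-1)).
  by move=> ?; apply/sE; rewrite !lerD2r !ler_int.
exists s; split=> //.
- exists (at_axis d ((if hi d A <= lo d B then i else j)%:~R + 2^-1) (k%:~R + 2^-1)).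
  case: ifP => orient; split; first [apply: in_s | apply/interior_cell];
    rewrite ?kA ?andbT /spans /i /j; clear - ltA ltB sepAB orient; lia.
- exists (at_axis d ((if hi d A <= lo d B then j else i)%:~R + 2^-1) (k%:~R + 2^-1)).
  case: ifP => orient; split; first [apply: in_s | apply/interior_cell];
    rewrite ?kB ?andbT /spans /i /j; clear - ltA ltB sepAB orient; lia.
move=> C CS CA CB; rewrite -subset0 => p; have [u [v ->]] := at_axis_surj d p.
move=> [/sE[/andP[u1 u2] ->] /region_at/andP[/andP[c1 c2]]].
rewrite half_le half_ge => kC.
have l1 : (i%:~R + 2^-1 <= (hi d C)%:~R :> R) by lra.
have l2 : ((lo d C)%:~R <= j%:~R + 2^-1 :> R) by lra.
move: l1 l2; rewrite half_le half_ge /i /j => l1 l2.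
have := clear C CS CA CB kC; clear - ltA ltB sepAB l1 l2; lia.
Qed.

(** * From representations to labelled grids *)

Lemma adjacent_sym es : symmetric (adjacent es).
Proof. by move=> u v; rewrite /adjacent eq_sym orbC. Qed.

Definition graph_of (n : nat) (es : seq (nat * nat)) : sgraph :=
  @SGraph 'I_n (fun u v => adjacent es u v)
    (fun u v => adjacent_sym es u v)
    (fun u => introF andP (fun H => negP (proj1 H) (eqxx _))).

Definition origin (S : {fset irect}) (d : bool) : int :=
  if d then bbox_x1 S else bbox_y1 S.
Definition extent (S : {fset irect}) (d : bool) : int :=
  if d then bbox_dx S else bbox_dy S.

Lemma bbox_bounds (S : {fset irect}) (d : bool) (A : irect) : A \in S ->
  origin S d <= lo d A /\ hi d A <= origin S d + extent S d.
Proof.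
move=> AS; have AS' : A \in enum_fset S by [].
rewrite /origin /extent /bbox_dx /bbox_dy; case: d => /=.
  by rewrite subrKC; split; [apply: min_int_le | apply: max_int_ge]; apply: map_f.
by rewrite subrKC; split; [apply: min_int_le | apply: max_int_ge]; apply: map_f.
Qed.

(** The vertex whose rectangle covers the unit cell (i, j) of the grid with
    origin (x0, y0), or [n] if there is none. *)
Definition owner (n : nat) (r : 'I_n -> irect) (x0 y0 : int) (i j : nat) : nat :=
  oapp val n
    [pick v | spans true (x0 + i%:Z) (r v) && spans false (y0 + j%:Z) (r v)].

Section OwnerDrawing.
Variables (R : realType) (n : nat) (es : seq (nat * nat)) (S : {fset irect}).
Variables (f : graph_of n es -> S).
Hypothesis disj : disjoint_interiors R S.
Hypothesis bij : bijective f.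
Hypothesis adj : forall u v : graph_of n es, u != v ->
  (edge u v <-> sees R S (val (f u)) (val (f v))).

Let r (v : 'I_n) : irect := val (f v).
Let lab d (i j : nat) : nat :=
  let p := at_axis d i j in owner r (origin S true) (origin S false) p.1 p.2.
Let cell d (i j : nat) A :=
  spans d (origin S d + i%:Z) A && spans (~~ d) (origin S (~~ d) + j%:Z) A.

Lemma rS v : r v \in S. Proof. exact: fsvalP. Qed.
Lemma r_inj : injective r.
Proof. by move=> u v /val_inj /(bij_inj bij). Qed.
Lemma r_surj A : A \in S -> exists v, r v = A.
Proof.
by move=> AS; case: bij => g _ fK; exists (g [` AS]%fset); rewrite /r fK.
Qed.

(** Two rectangles that share a cell have a common strip in which neither comes
    first. *)
Lemma cell_uniq d i j u v : cell d i j (r u) -> cell d i j (r v) -> u = v.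
Proof.
move=> /andP[u1 u2] /andP[v1 v2]; apply/eqP; apply: contraT => uv.
have := strip_apart disj (rS u) (rS v) _ u2 v2.
rewrite (inj_eq r_inj) => /(_ uv); move: u1 v1; rewrite /spans; clear; lia.
Qed.

Lemma lab_cell d i j (v : 'I_n) : (lab d i j == v) = cell d i j (r v).
Proof.
have -> : cell d i j (r v) = cell true (at_axis d i j).1 (at_axis d i j).2 (r v).
  by rewrite /cell; case: d => //=; rewrite andbC.
rewrite /lab /owner; case: pickP => [u /= cu|Nu /=].
  rewrite (inj_eq val_inj); apply/eqP/idP => [<- //|].
  exact: (cell_uniq cu).
by rewrite [RHS]Nu; apply/negP => /eqP E; have := ltn_ord v; rewrite -E ltnn.
Qed.

Lemma lab_le d i j : (lab d i j <= n)%N.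
Proof. by rewrite /lab /owner; case: pickP => [v _|//] /=; apply: ltnW. Qed.

Lemma lab_ord d i j : (lab d i j < n)%N -> exists2 v : 'I_n, lab d i j = v & cell d i j (r v).
Proof. by move=> lt; exists (Ordinal lt) => //; rewrite -lab_cell. Qed.

(** Between two consecutive labels [u] and [v] no third rectangle can come: it
    would start in a cell between them, and that cell would be labelled. *)
Lemma lab_lines d : line_rule n es (lab d).
Proof.
split=> [i k i' j /andP[lt_ik lt_ki'] /lab_ord[v -> cv] /eqP|].
  rewrite lab_cell => cv'; apply/eqP; rewrite lab_cell.
  move: cv cv' lt_ik lt_ki'; rewrite /cell /spans; clear; lia.
move=> i i' j lt_ii' /lab_ord[u -> cu] /lab_ord[v -> cv] Nk.
have [->|uv] := eqVneq u v; [by left | right].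
have [/andP[u1 u2] /andP[v1 v2]] := (cu, cv).
have ruv : r u != r v by rewrite (inj_eq r_inj).
apply/(adj (u := u) (v := v) uv).
apply: (sight_sees disj (rS u) (rS v) ruv (d := d) (k := origin S (~~ d) + j%:Z)).
split=> // C /r_surj[w <-] wu wv w2.
have sepu := strip_apart disj (rS w) (rS u) wu w2 u2.
have sepv := strip_apart disj (rS w) (rS v) wv w2 v2.
have ltw := lo_lt_hi d (r w); have [orgw _] := bbox_bounds d (rS w).
rewrite -[_ || _]negbK; apply/negP => Nsep.
pose k := `|lo d (r w) - origin S d|%N.
have [lt_ik lt_ki'] : (i < k)%N /\ (k < i')%N.
  move: u1 v1 lt_ii' Nsep sepu sepv ltw orgw; rewrite /spans /k; clear; lia.
suff /eqP : lab d k j == w by rewrite Nk ?lt_ik // => E; have := ltn_ord w; rewrite -E ltnn.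
rewrite lab_cell /cell w2 andbT; move: ltw orgw; rewrite /spans /k; clear; lia.
Qed.

(** The last cell of the first rectangle and the first cell of the second one in
    the strip carry consecutive labels. *)
Lemma lab_faces d k u v a b : extent S d <= a%:Z -> extent S (~~ d) <= b%:Z ->
  sight S d k (r u) (r v) -> hi d (r u) <= lo d (r v) ->
  faces n (lab d) a b u v.
Proof.
move=> le_a le_b [ku kv clr] sep.
have [ou _] := bbox_bounds d (rS u); have [_ ev] := bbox_bounds d (rS v).
have [oj ej] := bbox_bounds (~~ d) (rS u).
have [ltu ltv] := (lo_lt_hi d (r u), lo_lt_hi d (r v)).
exists `|(hi d (r u) - 1 - origin S d)%R|%N, `|lo d (r v) - origin S d|%N,
  `|k - origin S (~~ d)|%N.
have Ek : origin S (~~ d) + `|k - origin S (~~ d)|%N%:Z = k.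
  by move: ku oj; rewrite /spans; clear; lia.
split; first by split; move: ku le_a le_b sep ou ev oj ej ltu ltv; rewrite /spans; clear; lia.
split.
- apply/eqP; rewrite lab_cell /cell Ek ku andbT /spans.
  by move: ou ltu; clear; lia.
- apply/eqP; rewrite lab_cell /cell Ek kv andbT /spans.
  by move: ou sep ltu ltv; clear; lia.
move=> i /andP[lt1 lt2]; apply/eqP; rewrite eqn_leq lab_le /= leqNgt.
apply/negP => /lab_ord[w _]; rewrite /cell Ek => /andP[iw kw].
have wu : r w != r u.
  apply/negP => /eqP E; move: iw lt1 ou ltu; rewrite E /spans; clear; lia.
have wv : r w != r v.
  apply/negP => /eqP E; move: iw lt2 ou sep ltu; rewrite E /spans; clear; lia.
have := clr _ (rS w) wu wv kw.
move: iw lt1 lt2 ou ltu ltv sep; rewrite /spans; clear; lia.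
Qed.

Lemma owner_drawing (a b : nat) :
  extent S true <= a%:Z -> extent S false <= b%:Z -> drawing n es a b (lab true).
Proof.
move=> le_a le_b; split.
- exact: lab_le.
- move=> i j i' j' /lab_ord[v -> cv] /eqP; rewrite lab_cell => cv'.
  by apply/eqP; rewrite lab_cell; move: cv cv' => /andP[+ _] /andP[_ +];
    rewrite /cell => -> ->.
- exact: lab_lines.
- exact: (lab_lines false).
- move=> v lt_v; pose A := r (Ordinal lt_v).
  have [o1 e1] := bbox_bounds true (rS (Ordinal lt_v)).
  have [o2 e2] := bbox_bounds false (rS (Ordinal lt_v)).
  have [l1 l2] := (lo_lt_hi true A, lo_lt_hi false A).
  exists `|lo true A - origin S true|%N, `|lo false A - origin S false|%N.
  rewrite -/A in o1 e1 o2 e2; split.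
  + by move: o1 e1 l1 le_a; clear; lia.
  + by move: o2 e2 l2 le_b; clear; lia.
  apply/eqP; rewrite (lab_cell true _ _ (Ordinal lt_v)) /cell /spans.
  by move: o1 e1 l1 o2 e2 l2; rewrite -/A [~~ true]/=; clear; lia.
move=> u v lt_u lt_v uv; pose u' := Ordinal lt_u; pose v' := Ordinal lt_v.
have neq_uv : u' != v' by apply: contraTneq uv => -[->]; rewrite /adjacent eqxx.
have /(sees_sight disj (rS u') (rS v'))[d [k sk]] : sees R S (r u') (r v').
  exact/(adj (u := u') (v := v') neq_uv).
have sk' : sight S d k (r v') (r u').
  by case: sk => ku kv clr; split=> // C CS Cv Cu kC; rewrite minC maxC clr.
have [ku kv _] := sk.
have ruv : r u' != r v' by rewrite (inj_eq r_inj).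
case: d sk sk' ku kv => sk sk' ku kv.
  have [sep|sep] := orP (strip_apart disj (rS u') (rS v') ruv ku kv).
    by constructor 1; exact: lab_faces le_a le_b sk sep.
  by constructor 2; exact: lab_faces le_a le_b sk' sep.
have [sep|sep] := orP (strip_apart disj (rS u') (rS v') ruv ku kv).
  by constructor 3; exact: (lab_faces le_b le_a sk sep).
by constructor 4; exact: (lab_faces le_b le_a sk' sep).
Qed.
End OwnerDrawing.

(** * Bounding boxes and minimizers *)

Lemma extent_attained (S : {fset irect}) d : S != fset0 ->
  (exists2 A, A \in S & origin S d = lo d A) /\
  (exists2 B, B \in S & origin S d + extent S d = hi d B).
Proof.
move=> /fset0Pn[A0 A0S].
have ne (g : irect -> int) : [seq g A | A <- enum_fset S] != [::].
  by move: (A0S : A0 \in enum_fset S); case: (enum_fset S).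
rewrite /origin /extent /bbox_dx /bbox_dy; case: d => /=; rewrite subrKC; split.
- by have /mapP[A AS E] := min_int_in (ne rx1); exists A.
- by have /mapP[A AS E] := max_int_in (ne rx2); exists A.
- by have /mapP[A AS E] := min_int_in (ne ry1); exists A.
- by have /mapP[A AS E] := max_int_in (ne ry2); exists A.
Qed.

Lemma extent_gt0 (S : {fset irect}) d : S != fset0 -> 0 < extent S d.
Proof.
move=> /fset0Pn[A AS]; have [le1 le2] := bbox_bounds d AS.
by have := lo_lt_hi d A; lia.
Qed.

Lemma extent_ge0 (S : {fset irect}) d : 0 <= extent S d.
Proof.
have [->|/(extent_gt0 d)/ltW//] := eqVneq S fset0.
rewrite /extent /bbox_dx /bbox_dy /bbox_x1 /bbox_x2 /bbox_y1 /bbox_y2.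
by have -> : enum_fset (fset0 : {fset irect}) = [::] by []; case: d.
Qed.

Lemma extent_le (S : {fset irect}) d (m : nat) : S != fset0 ->
  (forall A, A \in S -> 0 <= lo d A /\ hi d A <= m%:Z) -> extent S d <= m%:Z.
Proof.
move=> S0 inm; have [[A AS EA] [B BS EB]] := extent_attained d S0.
by have [? _] := inm A AS; have [_ ?] := inm B BS; lia.
Qed.

Lemma param_rep_ge0 p S : 0 <= param_rep p S.
Proof.
have := extent_ge0 S true; have := extent_ge0 S false; rewrite /extent.
by case: p => /= dx dy; [rewrite mulr_ge0 | lia | lia | lia].
Qed.

(** Parameters are nonnegative integers, so their minima are attained. *)
Lemma param_min (R : realType) p G S : RV_representation R G S ->
  exists T, [/\ RV_representation R G T, param_graph R p G (param_rep p T)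
              & param_rep p T <= param_rep p S].
Proof.
move=> GS.
pose attained m := `[< exists2 T, RV_representation R G T & param_rep p T = m%:Z >].
have ex : exists m, attained m.
  by exists `|param_rep p S|%N; apply/asboolP; exists S; rewrite // gez0_abs ?param_rep_ge0.
case: (ex_minnP ex) => m /asboolP[T GT Tm] minm.
have leT U : RV_representation R G U -> param_rep p T <= param_rep p U.
  move=> GU; rewrite Tm -(gez0_abs (param_rep_ge0 p U)) lez_nat minm //.
  by apply/asboolP; exists U; rewrite // gez0_abs ?param_rep_ge0.
by exists T; split=> //; [split=> //; exists T | apply: leT].
Qed.

Definition separates (R : realType) (p q : param) (G : sgraph) : Prop :=
  [/\ RVG R G,
      exists S1 S2 : {fset irect},
        [/\ RV_representation R G S1, RV_representation R G S2,
            param_graph R p G (param_rep p S1) /\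
              param_rep p S1 < param_rep p S2
          & param_graph R q G (param_rep q S2) /\
              param_rep q S2 < param_rep q S1]
    & ~ exists S : {fset irect},
        [/\ RV_representation R G S,
            param_graph R p G (param_rep p S)
          & param_graph R q G (param_rep q S)]].

Lemma separates_sym (R : realType) p q G : separates R p q G -> separates R q p G.
Proof.
move=> [GR [S1 [S2 [? ? ? ?]]] no]; split=> //; first by exists S2, S1.
by move=> [S [? ? ?]]; apply: no; exists S.
Qed.

(** A minimizer of p satisfies the bound [s], so it violates the bound [t], which
    every minimizer of q satisfies; and symmetrically. *)
Lemma separates_bounds (R : realType) p q G (s t : int) S1 S2 :
  RV_representation R G S1 -> param_rep p S1 <= s ->
  RV_representation R G S2 -> param_rep q S2 <= t ->
  (forall S, RV_representation R G S -> param_rep p S <= s ->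
     param_rep q S <= t -> False) ->
  separates R p q G.
Proof.
move=> G1 le1 G2 le2 no.
have [T1 [GT1 min1 leT1]] := param_min p G1.
have [T2 [GT2 min2 leT2]] := param_min q G2.
have les := le_trans leT1 le1; have les' := le_trans leT2 le2.
split; first by exists S1.
  exists T1, T2; split=> //; split=> //; rewrite ltNge; apply/negP => le.
    by apply: (no T2) => //; apply: le_trans les.
  by apply: (no T1) => //; apply: le_trans les'.
move=> [S [GS [_ /(_ T1 GT1) leS1] [_ /(_ T2 GT2) leS2]]].
by apply: (no S) => //; [apply: le_trans les | apply: le_trans les'].
Qed.

(** * Representations read off pictures *)

Lemma brick_proof (x y w h : nat) :
  let c := ((x%:Z, (x + w.+1)%N%:Z), (y%:Z, (y + h.+1)%N%:Z)) in
  (c.1.1 < c.1.2) && (c.2.1 < c.2.2).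
Proof. by rewrite /= !ltz_nat; lia. Qed.

(** The sizes are [w.+1] and [h.+1], which makes every brick nondegenerate. *)
Definition brick (x y w h : nat) : irect := IRect (brick_proof x y w h).

(** A picture lists the rows of a grid of labels, and the rectangle of [v] is
    read off the first row in which [v] occurs and the number of such rows. *)
Definition pic_rect (P : seq (seq nat)) (v : nat) : irect :=
  let y := find (fun row => v \in row) P in
  let row := nth [::] P y in
  brick (index v row) y (count_mem v row).-1
    (count (fun row => v \in row) P).-1.

(** Decides [sight] for the rectangles of a picture. *)
Definition sightb (n : nat) (r : nat -> irect) (d : bool) (k u v : nat) : bool :=
  [&& spans (~~ d) k%:Z (r u), spans (~~ d) k%:Z (r v)
    & all (fun w => [&& w != u, w != v & spans (~~ d) k%:Z (r w)] ==>
        ((hi d (r w) <= Num.min (lo d (r u)) (lo d (r v)))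
         || (Num.max (hi d (r u)) (hi d (r v)) <= lo d (r w)))) (iota 0 n)].

(** Only strips below [maxn a b] need to be tried, as the picture lies in the box
    from (0, 0) to (a, b). *)
Definition depicts (n : nat) (es : seq (nat * nat)) (a b : nat)
    (P : seq (seq nat)) : bool :=
  let r := pic_rect P in
  (0 < n)%N &&
  all (fun v => [&& hi true (r v) <= a%:Z, hi false (r v) <= b%:Z
    & all (fun u => (u != v) ==> apart (r u) (r v) &&
        (adjacent es u v == has (fun d => has (fun k => sightb n r d k u v)
           (iota 0 (maxn a b))) [:: true; false])) (iota 0 n)]) (iota 0 n).

Lemma lo_brick d x y w h : 0 <= lo d (brick x y w h).
Proof. by case: d. Qed.

Lemma depicts_rep (R : realType) n es a b P : depicts n es a b P ->
  exists S, RV_representation R (graph_of n es) S /\ 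
    bbox_dx S <= a%:Z /\ bbox_dy S <= b%:Z.
Proof.
case/andP=> n_gt0 /allP ok; pose r (v : 'I_n) := pic_rect P v.
have inn (v : 'I_n) : (v : nat) \in iota 0 n by rewrite mem_iota ltn_ord.
have hi_r (v : 'I_n) : hi true (r v) <= a%:Z /\ hi false (r v) <= b%:Z.
  by have /and3P[] := ok v (inn v).
have okp (u v : 'I_n) : u != v -> apart (r u) (r v) /\
    adjacent es u v = has (fun d => has (fun k => sightb n (pic_rect P) d k u v)
           (iota 0 (maxn a b))) [:: true; false].
  have /and3P[_ _ /allP/(_ u (inn u))] := ok v (inn v).
  by rewrite (inj_eq val_inj) => /implyP H /H /andP[? /eqP ?].
have apart_irr A : ~~ apart A A.
  apply/hasPn => d _; rewrite orbb -ltNge; exact: lo_lt_hi.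
have r_inj : injective r.
  move=> u v E; apply/eqP; apply: contraT => /okp[+ _].
  by rewrite E => /(negP (apart_irr _)).
pose S : {fset irect} := [fset r v | v in 'I_n]%fset.
have rS v : r v \in S by apply/imfsetP; exists v.
have SP A : A \in S -> exists v, A = r v.
  by move=> /imfsetP[v _ ->]; exists v.
have disj : disjoint_interiors R S.
  move=> A B /SP[u ->] /SP[v ->]; rewrite (inj_eq r_inj) => /okp[+ _].
  exact: apart_interiors.
have sightP d (k : nat) (u v : 'I_n) :
    sight S d k%:Z (r u) (r v) <-> sightb n (pic_rect P) d k u v.
  split=> [[ku kv clr]|/and3P[ku kv /allP clr]].
    apply/and3P; split=> //; apply/allP => w; rewrite mem_iota add0n /= => lt_w.
    pose w' := Ordinal lt_w; apply/implyP => /and3P[wu wv kw].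
    by apply: (clr (r w')) => //; rewrite (inj_eq r_inj).
  split=> // C /SP[w ->]; rewrite !(inj_eq r_inj) => wu wv kw.
  by apply: (implyP (clr w (inn w))); rewrite kw andbT; apply/andP; split.
exists S; split; last first.
  have S0 : S != fset0 by apply/fset0Pn; exists (r (Ordinal n_gt0)).
  have lo_r d v : 0 <= lo d (r v) by apply: lo_brick.
  split; [apply: (extent_le (d := true)) | apply: (extent_le (d := false))] => //;
    by move=> _ /SP[v ->]; split; rewrite ?lo_r //; have [] := hi_r v.
split=> //; exists (fun v => [` rS v]%fset); split.
  apply: inj_card_bij => [u v /(congr1 val)/r_inj//|].
  by rewrite -cardfE card_imfset //= -cardE.
move=> u v uv; have [_ adjE] := okp u v uv.
have ruv : r u != r v by rewrite (inj_eq r_inj).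
rewrite /= adjE; split.
  move=> /hasP[d _ /hasP[k _ /sightP]].
  exact: sight_sees.
move=> /(sees_sight disj (rS u) (rS v))[d [k sk]].
apply/hasP; exists d; first by case: (d).
have [ku _ _] := sk; have [hi1 hi2] := hi_r u.
have k_ge0 : 0 <= k.
  by move: ku => /andP[+ _]; apply: le_trans; apply: lo_brick.
apply/hasP; exists `|k|%N; last by apply/sightP; rewrite gez0_abs.
rewrite mem_iota add0n /=; move: ku hi1 hi2 k_ge0; rewrite /spans.
by case: (d) => /=; clear; lia.
Qed.

Lemma rep_nonempty (R : realType) n es S : (0 < n)%N ->
  RV_representation R (graph_of n es) S -> S != fset0.
Proof.
move=> n_gt0 [_ [f _]]; apply/fset0Pn.
by exists (val (f (Ordinal n_gt0))); apply: fsvalP.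
Qed.

(** * The three graphs *)

Definition fits (x y : int) (a b : nat) : Prop :=
  x <= a%:Z /\ y <= b%:Z \/ x <= b%:Z /\ y <= a%:Z.

Definition refuted (n : nat) (es : seq (nat * nat)) (a b : nat) : bool :=
  ~~ search n es a (a * b) [::] && ~~ search n es b (b * a) [::].

Lemma refuted_fits (R : realType) n es a b S :
  simple_edges n es -> refuted n es a b ->
  RV_representation R (graph_of n es) S -> ~ fits (bbox_dx S) (bbox_dy S) a b.
Proof.
move=> simple_es /andP[Nab Nba] [disj [f [bij adj]]].
by case=> -[le1 le2]; [apply/negP: Nab | apply/negP: Nba]; apply/negPn;
  apply: (search_drawing simple_es (owner_drawing disj bij adj le1 le2)).
Qed.

Definition param_val (p : param) (x y : int) : int :=
  match p with
  | Area => x * y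
  | Perimeter => 2 * (x + y)
  | Height => Num.min x y
  | Width => Num.max x y
  end.

Lemma param_rep_val p S : param_rep p S = param_val p (bbox_dx S) (bbox_dy S).
Proof. by case: p. Qed.

Lemma param_val_mono p (x y a b : int) : 0 <= x -> 0 <= y -> x <= a -> y <= b ->
  param_val p x y <= param_val p a b.
Proof. by case: p => /=; [exact: ler_pM | lia | lia | lia]. Qed.

(** The two pictures supply the bounds on p and q, and every box that meets both
    bounds fits, in one of its two orientations, into a refuted one. *)
Lemma pictures_separate (R : realType) p q n es boxes a1 b1 P1 a2 b2 P2 :
  simple_edges n es -> all (fun w => refuted n es w.1 w.2) boxes ->
  depicts n es a1 b1 P1 -> depicts n es a2 b2 P2 ->
  (forall x y : int, 0 < x -> 0 < y ->
     param_val p x y <= param_val p a1 b1 ->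
     param_val q x y <= param_val q a2 b2 ->
     exists2 w, w \in boxes & fits x y w.1 w.2) ->
  separates R p q (graph_of n es).
Proof.
move=> simple_es /allP no_box pic1 pic2 bounds.
have [S1 [GS1 [dx1 dy1]]] := depicts_rep R pic1.
have [S2 [GS2 [dx2 dy2]]] := depicts_rep R pic2.
apply: (separates_bounds (s := param_val p a1 b1) (t := param_val q a2 b2)
  GS1 _ GS2).
- by rewrite param_rep_val param_val_mono ?(extent_ge0 _ true)
    ?(extent_ge0 _ false).
- by rewrite param_rep_val param_val_mono ?(extent_ge0 _ true)
    ?(extent_ge0 _ false).
move=> S GS; rewrite !param_rep_val => les let'.
have S0 : S != fset0 by case/andP: pic1 => n_gt0 _; apply: rep_nonempty GS.
have [w w_box] := bounds _ _ (extent_gt0 true S0) (extent_gt0 false S0) les let'.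
exact: refuted_fits (no_box w w_box) GS.
Qed.

Definition star : seq (nat * nat) := [seq (0%N, i) | i <- iota 1 4].

Definition ladder (k : nat) : seq (nat * nat) :=
  [seq (i.*2, i.*2.+1) | i <- iota 0 k] ++
  [seq (i, i.+2) | i <- iota 0 (k.*2 - 2)].

Definition corner_ladder : seq (nat * nat) :=
  ladder 4 ++ [:: (0, 8); (8, 9); (9, 10); (10, 0)]%N.

(* In the pictures the number of vertices marks the blank cells. *)

Definition star_square : seq (seq nat) :=
  [:: [:: 5; 1; 5];
      [:: 2; 0; 3];
      [:: 5; 4; 5]]%N.

Definition star_flat : seq (seq nat) :=
  [:: [:: 1; 5; 0; 3; 5];
      [:: 5; 2; 0; 5; 4]]%N.

Definition ladder_square : seq (seq nat) :=
  [:: [:: 10; 10; 0; 1];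
      [:: 10; 10; 2; 3];
      [:: 8; 6; 4; 10];
      [:: 9; 7; 5; 5]]%N.

Definition ladder_flat : seq (seq nat) :=
  [:: [:: 0; 2; 4; 6; 8];
      [:: 1; 3; 5; 7; 9]]%N.

Definition corner_square : seq (seq nat) :=
  [:: [:: 11; 11; 11; 8; 9];
      [:: 6; 4; 2; 0; 10];
      [:: 7; 5; 3; 1; 11]]%N.

Definition corner_flat : seq (seq nat) :=
  [:: [:: 8; 11; 0; 11; 2; 4; 6];
      [:: 9; 10; 0; 1; 3; 5; 7]]%N.

Lemma star_square_depicts : depicts 5 star 3 3 star_square.
Proof. by vm_compute. Qed.

Lemma star_flat_depicts : depicts 5 star 5 2 star_flat.
Proof. by vm_compute. Qed.

Lemma ladder_square_depicts : depicts 10 (ladder 5) 4 4 ladder_square.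
Proof. by vm_compute. Qed.

Lemma ladder_flat_depicts : depicts 10 (ladder 5) 5 2 ladder_flat.
Proof. by vm_compute. Qed.

Lemma corner_square_depicts : depicts 11 corner_ladder 5 3 corner_square.
Proof. by vm_compute. Qed.

Lemma corner_flat_depicts : depicts 11 corner_ladder 7 2 corner_flat.
Proof. by vm_compute. Qed.

Definition star_boxes : seq (nat * nat) := [:: (1, 9); (2, 4)]%N.
Definition ladder_boxes : seq (nat * nat) := [:: (3, 4)]%N.
Definition corner_boxes : seq (nat * nat) := [:: (1, 7); (2, 6); (3, 4)]%N.

Lemma star_refuted : all (fun w => refuted 5 star w.1 w.2) star_boxes.
Proof. by vm_cast_no_check (erefl true). Qed.

Lemma ladder_refuted : all (fun w => refuted 10 (ladder 5) w.1 w.2) ladder_boxes.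
Proof. by vm_cast_no_check (erefl true). Qed.

Lemma corner_refuted :
  all (fun w => refuted 11 corner_ladder w.1 w.2) corner_boxes.
Proof. by vm_cast_no_check (erefl true). Qed.

Lemma area_height R : separates R Area Height (graph_of 5 star).
Proof.
apply: (pictures_separate _ _ star_refuted star_square_depicts star_flat_depicts)
  => // x y x_gt0 y_gt0 /= le1 le2.
have [le_m|lt_m] : Num.min x y <= 1 \/ 2 <= Num.min x y by lia.
  by exists (1, 9)%N => //; rewrite /fits /=; nia.
by exists (2, 4)%N => //; rewrite /fits /=; nia.
Qed.

Lemma ladder_separates R p : p <> Width ->
  separates R p Width (graph_of 10 (ladder 5)).
Proof.
move=> p_neq; apply: (pictures_separate _ _ ladder_refuted ladder_flat_depicts
  ladder_square_depicts) => // x y x_gt0 y_gt0 le1 /= le2.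
exists (3, 4)%N => //; rewrite /fits /=.
by case: p p_neq le1 => //= _ le1; nia.
Qed.

Lemma corner_separates R p : p = Area \/ p = Height ->
  separates R p Perimeter (graph_of 11 corner_ladder).
Proof.
move=> p_eq; apply: (pictures_separate _ _ corner_refuted corner_flat_depicts
  corner_square_depicts) => // x y x_gt0 y_gt0 le1 /= le2.
have le14 : x * y <= 14 \/ Num.min x y <= 2.
  by case: p_eq le1 => -> /= le1; [left | right]; lia.
have [le_m|[eq_m|lt_m]] : Num.min x y <= 1 \/ Num.min x y = 2 \/ 3 <= Num.min x y.
  lia.
- by exists (1, 7)%N => //; rewrite /fits /=; lia.
- by exists (2, 6)%N => //; rewrite /fits /=; lia.
- by exists (3, 4)%N => //; rewrite /fits /=; nia.
Qed.

Theorem mainTheorem2 (R : realType) (p q : param) (hpq : p <> q) :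
  exists G : sgraph,
    [/\ RVG R G,
        exists S1 S2 : {fset irect},
          [/\ RV_representation R G S1, RV_representation R G S2,
              param_graph R p G (param_rep p S1) /\
                param_rep p S1 < param_rep p S2
            & param_graph R q G (param_rep q S2) /\
                param_rep q S2 < param_rep q S1]
      & ~ exists S : {fset irect},
          [/\ RV_representation R G S,
              param_graph R p G (param_rep p S)
            & param_graph R q G (param_rep q S)]].
Proof.
suff [G sep] : exists G, separates R p q G by exists G.
case: p q hpq => [] [] // _.
- by exists (graph_of 11 corner_ladder); apply: corner_separates; left.
- by exists (graph_of 5 star); apply: area_height.
- by exists (graph_of 10 (ladder 5)); apply: ladder_separates.
- by exists (graph_of 11 corner_ladder); apply/separates_sym/corner_separates; left.
- by exists (graph_of 11 corner_ladder); apply/separates_sym/corner_separates; right.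
- by exists (graph_of 10 (ladder 5)); apply: ladder_separates.
- by exists (graph_of 5 star); apply/separates_sym/area_height.
- by exists (graph_of 11 corner_ladder); apply: corner_separates; right.
- by exists (graph_of 10 (ladder 5)); apply: ladder_separates.
- by exists (graph_of 10 (ladder 5)); apply/separates_sym/ladder_separates.
- by exists (graph_of 10 (ladder 5)); apply/separates_sym/ladder_separates.
- by exists (graph_of 10 (ladder 5)); apply/separates_sym/ladder_separates.
Qed.
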